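(* Let $\mu\in(1,2]$. For odd $n=2m+1$ put $\rho_n=1/\sqrt n$ and let $Y_1,\dots,Y_n$ be i.i.d. copies of $Y=\theta^*+\zeta$ with $\theta^*=0$, where $\zeta$ is a real random variable whose law has an atom of mass $\rho_n$ at $0$ and, apart from this atom, has density \[ x\mapsto\frac{(1-\rho_n)\mu}{2|x|^{\mu+1}}\mathbf{1}_{\{|x|\ge1\}}. \] Let $R_{\ell_1}(\theta)=\mathbb{E}|Y-\theta|$ for $\theta\in\mathbb{R}$ (which is minimized at $\theta^*=0$), and let \[ \bar\theta=\mathop{\arg\min}_{\theta\in\mathbb{R}}\frac1n\sum_{i=1}^n|Y_i-\theta| \] be the least absolute deviation estimator, i.e. the median $Y_{(m+1)}$ of $Y_1,\dots,Y_{2m+1}$. Then there is a constant $n_0\in\mathbb{N}$ such that for all (odd) $n\ge n_0$, \[ \mathbb{P}\left(R_{\ell_1}(\bar\theta)-R_{\ell_1}(\theta^* )\ge\frac1{\sqrt n}\right)\ge\frac{9}{16e^2}. \]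
   Context: $Y_{(r)}$ denotes the $r$-th order statistic of the sample $Y_1,\dots,Y_n$. Note that the distribution of $Y$ depends on the sample size $n$ through $\rho_n$. *)

(* Defs.v *)
From mathcomp Require Import all_boot all_order all_algebra.
From mathcomp Require Import all_classical all_reals all_analysis.

Set Implicit Arguments.
Unset Strict Implicit.
Unset Printing Implicit Defensive.

Import Order.TTheory GRing.Theory Num.Theory.
Import numFieldNormedType.Exports.

Local Open Scope classical_set_scope.
Local Open Scope ring_scope.

Definition argmin {R : realType} {disp : Order.disp_t} {U : porderType disp}
    (f : R -> U) : set R :=
  [set t | forall s, (f t <= f s)%O].

(* [order_stat y r] is the r-th smallest entry of the sample y, with r counted
   from 1; the default value 0 is only reached when r > n. *)
Definition order_stat {R : realType} (n : nat) (y : 'I_n -> R) (r : nat) : R :=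
  nth 0 (sort <=%R [seq y i | i <- enum 'I_n]) r.-1.

Definition empirical_l1_risk {R : realType} (n : nat) (y : 'I_n -> R)
    (theta : R) : R :=
  n%:R^-1 * \sum_(i < n) `|y i - theta|.

(* Extended-real valued, so that no integrability of Y is built in. *)
Definition l1_risk {R : realType} {d : measure_display} {T : measurableType d}
    (P : probability T R) (Y : T -> R) (theta : R) : \bar R :=
  ('E_P[fun w => `|Y w - theta|%R])%E.

Definition noise_density {R : realType} (mu rho x : R) : R :=
  (1 - rho) * mu / (2 * `|x| `^ (mu + 1)) * \1_[set z : R | 1 <= `|z|] x.

Definition has_noise_law {R : realType} {d : measure_display}
    {T : measurableType d} (P : probability T R) (zeta : {RV P >-> R})
    (mu rho : R) : Prop :=
  forall A : set R, measurable A ->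
    (distribution P zeta A =
      rho%:E * \d_(0%R : R) A
      + \int[lebesgue_measure]_(x in A) (noise_density mu rho x)%:E)%E.

Definition identically_distributed {R : realType}
    {d d' : measure_display} {T : measurableType d} {T' : measurableType d'}
    (P : probability T R) (X : T -> R) (P' : probability T' R) (X' : T' -> R) :
    Prop :=
  forall A : set R, measurable A -> P (X @^-1` A) = P' (X' @^-1` A).

(* Taking A i = setT for the indices to be dropped gives the product rule for
   every subfamily. *)
Definition mutually_independent {R : realType} {d : measure_display}
    {T : measurableType d} (P : probability T R) (n : nat)
    (Y : 'I_n -> {RV P >-> R}) : Prop :=
  forall A : 'I_n -> set R, (forall i, measurable (A i)) ->
    P (\bigcap_(i in [set: 'I_n]) (Y i @^-1` A i))
    = (\prod_(i < n) P (Y i @^-1` A i))%E.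

(* Main.v *)
(** Since the noise is symmetric, [R(theta) = E max(|zeta|, |theta|)], so that
    [R(theta) - R(0) = E (|theta| - |zeta|)^+], which equals [rho |theta|] for
    [|theta| <= 1] and is at least [rho] for [|theta| >= 1]. The excess risk is
    therefore at least [rho = 1 / sqrt n] exactly when the median lies outside
    [(-1, 1)], i.e. when a strict majority of the sample lies in [[1, +oo)] or in
    [(-oo, -1]]. These two events are disjoint, and each has the probability that
    a binomial variable with parameters [n] and [(1 - rho) / 2] exceeds [n / 2].

    Compare this binomial law with the symmetric one. With [k] successes and
    [x = 2 k - n > 0] the likelihood ratio is
    [(1 - rho^2)^(n - k) (1 - rho)^x >= e^(-1/2) e^(-3/2 rho x)], and as
    [rho x] has second moment [1] under the symmetric law, a convexity bound
    on the exponential gives a total probability of at least [e^(-2)], for every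
    [n >= 9]. *)

From HB Require Import structures.
Require Import Defs.
From mathcomp Require Import all_boot all_order all_algebra.
From mathcomp Require Import all_classical all_reals all_analysis.
From mathcomp Require Import measurable_realfun ring lra zify.

Import Order.TTheory GRing.Theory Num.Theory.
Import numFieldNormedType.Exports.

Local Open Scope classical_set_scope.
Local Open Scope ring_scope.

Set Implicit Arguments.
Unset Strict Implicit.
Unset Printing Implicit Defensive.

(** * The biased binomial tail *)

(** For uniformly random [S] this is a sum of independent Rademacher signs; the signed form lets its
    square expand over pairs of indices. *)
Definition imbalance {R : pzRingType} {I : finType} (S : {set I}) : R :=
  \sum_i (-1) ^+ (i \notin S).

Lemma imbalanceE (R : pzRingType) (I : finType) (S : {set I}) :
  imbalance S = #|S|%:R - #|~: S|%:R :> R.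
Proof.
rewrite /imbalance (bigID (mem S)) /=; congr (_ + _).
  by rewrite (eq_bigr (fun=> 1)) ?sumr_const// => i ->.
rewrite (eq_bigr (fun=> -1)); last by move=> i ->; rewrite expr1.
by rewrite sumr_const mulNrn; congr (- _%:R);
  apply: eq_card => i; rewrite !inE.
Qed.

(** Second moment of a symmetric walk: diagonal products of signs are 1, and off-diagonal ones
    cancel when the membership of a single index is toggled. *)
Lemma sum_sqr_imbalance (R : realDomainType) (I : finType) :
  \sum_(S : {set I}) (imbalance S : R) ^+ 2 = #|I|%:R * 2 ^+ #|I|.
Proof.
under eq_bigr do rewrite expr2 /imbalance big_distrlr.
rewrite exchange_big /=.
under eq_bigr do rewrite exchange_big /=.
pose flip (i : I) (S : {set I}) := [set x in I | (x \in S) (+) (x == i)]%SET.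
have flipK i : involutive (flip i).
  by move=> S; apply/setP => x; rewrite !inE -addbA addbb addbF.
have sum_diag (i : I) :
    \sum_(S : {set I}) (-1) ^+ (i \notin S) * (-1) ^+ (i \notin S) = 2 ^+ #|I| :> R.
  rewrite (eq_bigr (fun=> 1)); last by move=> S _; rewrite -signr_addb addbb.
  by rewrite sumr_const -[#|_|]cardsT -powersetT card_powerset cardsT natrX.
have sum_off (i j : I) : j != i ->
    \sum_(S : {set I}) (-1) ^+ (i \notin S) * (-1) ^+ (j \notin S) = 0 :> R.
  move=> ji; set s := \sum_(S : _) _.
  (* Toggling [i] reverses the sign at [i] and, since [j != i], keeps the sign at [j]. *)
  suff sN : s = - s by lra.
  rewrite {1}/s (reindex_inj (inv_inj (flipK i))) /= -sumrN.
  apply: eq_bigr => S _; rewrite !inE eqxx (negbTE ji) addbF addbT.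
  by case: (i \in S); case: (j \in S); rewrite /= ?expr0 ?expr1; ring.
under eq_bigr => i _.
  rewrite (bigD1 i)//= sum_diag big1 ?addr0; last by move=> j /sum_off.
  over.
by rewrite sumr_const mulr_natl.
Qed.

(* The linear lower bound is the tangent line of [expR] at the point where
   [rho * imbalance S = 1], combined with [2 rho x <= 1 + rho^2 x^2]. *)
Lemma heavy_weight_ge (R : realType) (m : nat) (S : {set 'I_m.*2.+1}) (rho : R) :
  0 < rho <= 1 / 3 -> rho ^+ 2 * m.*2.+1%:R = 1 -> (m < #|S|)%N ->
  expR (- 2) * (7 / 4 - 3 / 4 * (rho ^+ 2 * imbalance S ^+ 2))
    <= (1 - rho) ^+ #|S| * (1 + rho) ^+ #|~: S|.
Proof.
move=> /andP[rho0 rho3] rhon mS.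
have SC : (#|S| + #|~: S| = m.*2.+1)%N by rewrite cardsC card_ord.
set j := #|~: S| in SC *.
have jm : (j <= m)%N by lia.
(* Pairing each of the [j] failures with a success produces [(1 - rho ^+ 2) ^+ j]; the unpaired
   successes are counted by the imbalance. *)
have -> : #|S| = (j + (m - j).*2.+1)%N by lia.
rewrite exprD [X in _ <= X]mulrAC -[X in _ <= X * _]exprMn.
have -> : (1 - rho) * (1 + rho) = 1 - rho ^+ 2 by ring.
have dev : imbalance S = (m - j).*2.+1%:R :> R.
  rewrite imbalanceE -/j; have -> : #|S| = (j + (m - j).*2.+1)%N by lia.
  by rewrite natrD; ring.
rewrite dev; set k := (m - j).*2.+1.
have m0 : (0 < m)%N.
  rewrite lt0n; apply: contraPneq rhon => -> /eqP.
  by rewrite double0 mulr1 lt_eqF// expr2; nra.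
have mR : 0 < m%:R :> R by rewrite ltr0n.
have nE : m.*2.+1%:R = 2 * m%:R + 1 :> R by rewrite -addn1 natrD -muln2 natrM mulrC.
(* By [rhon], [1 - rho ^+ 2] is [2m / (2m + 1)], whose inverse [1 + 1 / (2m)] is at most
   [expR (1 / (2m))]. With [j <= m] the [j]-th power then costs at most [expR (- (1 / 2))]. *)
have e1 : expR (- (2 * m%:R)^-1) <= 1 - rho ^+ 2 :> R.
  rewrite expRN -[X in _ <= X]invrK lef_pV2 ?posrE ?expR_gt0//; last first.
    by rewrite invr_gt0; nra.
  apply: le_trans (expR_ge1Dx _).
  have r2 : rho ^+ 2 = (2 * m%:R + 1)^-1.
    by rewrite -nE; apply: (mulIf (x := m.*2.+1%:R)); rewrite ?pnatr_eq0// rhon mulVf ?pnatr_eq0.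
  have -> : (1 - rho ^+ 2)^-1 = 1 + (2 * m%:R)^-1 by rewrite r2; field; lra.
  by [].
have e2 : expR (- (1 / 2)) <= (1 - rho ^+ 2) ^+ j.
  apply: (@le_trans _ _ (expR (- (2 * m%:R)^-1) ^+ j)); last first.
    by rewrite lerXn2r ?nnegrE ?expR_ge0//; nra.
  rewrite -expRM_natl ler_expR mulrN lerN2 ler_pdivrMr; last by lra.
  have : j%:R <= m%:R :> R by rewrite ler_nat.
  lra.
(* For [rho > 0], [1 <= (1 + 3 / 2 * rho) * (1 - rho)] is equivalent to [rho <= 1 / 3], which is the
   source of the bound on [rho]. *)
have e3 : expR (- (3 / 2 * rho)) <= 1 - rho :> R.
  rewrite expRN -[X in _ <= X]invrK lef_pV2 ?posrE ?expR_gt0//; last first.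
    by rewrite invr_gt0; lra.
  apply: le_trans (expR_ge1Dx _).
  rewrite -div1r ler_pdivrMr; last by lra.
  nra.
have e4 : expR (- (3 / 2)) * (1 + (3 / 2 - 3 / 2 * (rho * k%:R))) <= (1 - rho) ^+ k.
  apply: (@le_trans _ _ (expR (- (3 / 2 * rho)) ^+ k)); last first.
    by rewrite lerXn2r ?nnegrE ?expR_ge0//; lra.
  rewrite -expRM_natl.
  have -> : k%:R * - (3 / 2 * rho) = - (3 / 2) + (3 / 2 - 3 / 2 * (rho * k%:R)) by ring.
  by rewrite expRD ler_pM2l ?expR_gt0// expR_ge1Dx.
have e5 : 7 / 4 - 3 / 4 * (rho ^+ 2 * k%:R ^+ 2) <= 1 + (3 / 2 - 3 / 2 * (rho * k%:R)).
  have := sqr_ge0 (rho * k%:R - 1); rewrite -exprMn; nra.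
have -> : - 2 = - (1 / 2) + - (3 / 2) :> R by lra.
rewrite expRD -mulrA.
(* The quadratic lower bound may be negative, so [e2] is only ever multiplied by the nonnegative
   [(1 - rho) ^+ k]. *)
apply: (@le_trans _ _ (expR (- (1 / 2)) * (1 - rho) ^+ k)).
  rewrite ler_pM2l ?expR_gt0//; apply: le_trans e4.
  by rewrite ler_pM2l ?expR_gt0.
by rewrite ler_wpM2r// exprn_ge0//; lra.
Qed.

(** The ground set has odd size, so complementation exchanges the sets with more than [m] elements
    and the remaining ones. *)
Lemma sum_heavy (R : nmodType) (m : nat) (g : {set 'I_m.*2.+1} -> R) :
  (forall S, g (~: S)%SET = g S) ->
  (\sum_(S : {set 'I_m.*2.+1} | (m < #|S|)%N) g S) *+ 2 = \sum_S g S.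
Proof.
move=> gC; rewrite [RHS](bigID (fun S : {set _} => m < #|S|)%N) /= mulr2n.
congr (_ + _); rewrite (reindex_inj (inv_inj (@finset.setCK _))) /=.
apply: eq_big => [S|S _]; last by rewrite gC.
have := cardsC S; rewrite card_ord /= -leqNgt => SC.
by apply/idP/idP; lia.
Qed.

(** The bound of [heavy_weight_ge] is even in the imbalance, so twice its heavy sum is the full sum.
    There [rho ^+ 2 * imbalance S ^+ 2] averages to 1, which leaves [7 / 4 - 3 / 4 = 1]. *)
Lemma binomial_tail_ge (R : realType) (m : nat) (rho : R) :
  0 < rho <= 1 / 3 -> rho ^+ 2 * m.*2.+1%:R = 1 ->
  expR (- 2) <= (\sum_(S : {set 'I_m.*2.+1} | (m < #|S|)%N)
    ((1 - rho) / 2) ^+ #|S| * ((1 + rho) / 2) ^+ #|~: S|) *+ 2.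
Proof.
move=> rho03 rhon.
pose g (S : {set 'I_m.*2.+1}) : R :=
  (expR (- 2) * (7 / 4 - 3 / 4 * (rho ^+ 2 * imbalance S ^+ 2))) / 2 ^+ m.*2.+1.
have gC S : g (~: S)%SET = g S.
  have -> : g (~: S)%SET = (expR (- 2) * (7 / 4 - 3 / 4 *
      (rho ^+ 2 * (- imbalance S) ^+ 2))) / 2 ^+ m.*2.+1.
    by rewrite /g !imbalanceE finset.setCK opprB.
  by rewrite sqrrN.
apply: (@le_trans _ _ ((\sum_(S : {set 'I_m.*2.+1} | (m < #|S|)%N) g S) *+ 2)).
  rewrite (sum_heavy gC) -mulr_suml -mulr_sumr sumrB sumr_const.
  rewrite -mulr_sumr -mulr_sumr sum_sqr_imbalance card_ord.
  rewrite -[#|_|]cardsT -powersetT card_powerset cardsT card_ord.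
  set n := m.*2.+1 in rhon *.
  rewrite (mulrA (rho ^+ 2)) rhon mul1r -(mulr_natr (7 / 4)) natrX.
  rewrite ler_pdivlMr ?exprn_gt0// ler_pM2l ?expR_gt0//; lra.
rewrite lerMn2r; apply/orP; right; apply: ler_sum => S mS.
rewrite /g ler_pdivrMr ?exprn_gt0// !expr_div_n.
apply: le_trans (heavy_weight_ge _ rhon mS) _ => //.
have SC : (#|S| + #|~: S| = m.*2.+1)%N by rewrite cardsC card_ord.
have -> : 2 ^+ m.*2.+1 = 2 ^+ #|S| * 2 ^+ #|~: S| :> R by rewrite -exprD SC.
rewrite mulrACA !mulfVK ?expf_neq0//.
Qed.

(** * Medians *)

Lemma card_order_stat (R : realType) (n : nat) (y : 'I_n -> R) (p : pred R) :
  #|[set i | p (y i)]%SET| = count p (sort <=%R [seq y i | i <- enum 'I_n]).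
Proof.
rewrite (permP (permEl (perm_sort _ _))) count_map cardE -size_filter enumT.
by congr size; apply: eq_filter => i; rewrite !inE.
Qed.

Lemma order_stat_le_card (R : realType) (m : nat) (y : 'I_m.*2.+1 -> R) :
  (m < #|[set i | (y i <= order_stat y m.+1)%R]%SET|)%N.
Proof.
rewrite (card_order_stat y (<= order_stat y m.+1)) /order_stat /=.
set s := sort _ _; have sz : size s = m.*2.+1.
  by rewrite size_sort size_map size_enum_ord.
have srt : sorted <=%R s by exact: (sort_sorted (@le_total _ R)).
rewrite ltnNge; apply/negP => cm.
(* The rank [m.+1] is position [m] counted from 0; too few entries below it would make that entry
   smaller than itself. *)
have := nth_count_gt 0 srt (x := nth 0 s m) (i := m).
by rewrite cm sz ltxx => /(_ _)/negP; apply; lia.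
Qed.

Lemma order_stat_ge_card (R : realType) (m : nat) (y : 'I_m.*2.+1 -> R) :
  (m < #|[set i | (order_stat y m.+1 <= y i)%R]%SET|)%N.
Proof.
rewrite (card_order_stat y (>= order_stat y m.+1)) /order_stat /=.
set s := sort _ _; have sz : size s = m.*2.+1.
  by rewrite size_sort size_map size_enum_ord.
have srt : sorted <=%R s by exact: (sort_sorted (@le_total _ R)).
have [mc|] := ltnP m (count (< nth 0 s m) s); last first.
  by rewrite count_lt_ge sz; move: (count _ _) => c; lia.
by have := nth_count_lt 0 srt mc; rewrite ltxx.
Qed.

(** Moving from [a] up to [t] lengthens a strict majority of the distances by [t - a] and shortens
    each other one by at most that. The slack [|t - a|] later gives uniqueness of the minimizer. *)
Lemma sum_dist_median_ge (R : realDomainType) (m : nat) (y : 'I_m.*2.+1 -> R) (a t : R) :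
  (m < #|[set i | (y i <= a)%R]%SET|)%N ->
  (m < #|[set i | (a <= y i)%R]%SET|)%N ->
  \sum_i `|y i - a| + `|t - a| <= \sum_i `|y i - t|.
Proof.
wlog at_ : a t y / a <= t.
  (* Reflecting the sample exchanges the two majority hypotheses, which covers [t < a]. *)
  move=> hw le_a ge_a; have [at_|/ltW ta] := leP a t; first exact: hw.
  have := hw (- a) (- t) (fun i => - y i).
  rewrite lerN2 ta => /(_ isT).
  under eq_finset do rewrite lerN2.
  move=> /(_ ge_a); under eq_finset do rewrite lerN2.
  move=> /(_ le_a).
  rewrite -opprD normrN.
  under eq_bigr do rewrite -opprD normrN.
  by under [X in _ <= X]eq_bigr do rewrite -opprD normrN.
move=> le_a _; set A := [set i | _]%SET in le_a.
have cA : (#|~: A| <= m)%N by have := cardsC A; rewrite card_ord; lia.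
have step i : `|y i - a| + (t - a) * (-1) ^+ (i \notin A) <= `|y i - t|.
  rewrite inE; have [ya|ya] := leP (y i) a; rewrite /= ?expr0 ?expr1.
    by rewrite !ler0_norm; lra.
  by have := ler_distD t (y i) a; rewrite (@ger0_norm _ (t - a)); lra.
apply: le_trans (ler_sum _ (fun i _ => step i)).
(* The total gain is [(t - a) * imbalance A], and a strict majority has imbalance at least 1. *)
rewrite big_split /= lerD2l -mulr_sumr -/(imbalance A) imbalanceE.
rewrite ger0_norm ?subr_ge0// ler_peMr ?subr_ge0//.
have := cardsC A; rewrite card_ord lerBrDr nat1r ler_nat; lia.
Qed.

Lemma argmin_empirical_l1_risk (R : realType) (m : nat) (y : 'I_m.*2.+1 -> R) :
  argmin (empirical_l1_risk y) = [set order_stat y m.+1].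
Proof.
have n0 : 0 < m.*2.+1%:R^-1 :> R by rewrite invr_gt0 ltr0n.
set a := order_stat y m.+1.
have key t : \sum_i `|y i - a| + `|t - a| <= \sum_i `|y i - t|.
  by apply: sum_dist_median_ge; rewrite ?order_stat_le_card ?order_stat_ge_card.
apply/seteqP; split=> [t /(_ a)|_ -> t]; rewrite /empirical_l1_risk ler_pM2l//=.
  have := key t => k1 k2; apply/eqP; rewrite -subr_eq0 -normr_le0.
  by rewrite -(lerD2l (\sum_i `|y i - a|)) addr0 (le_trans k1).
by apply: le_trans (key t); rewrite lerDl.
Qed.

(** Pigeonhole. It serves both to locate the median relative to a threshold and to separate the two
    outlier events. *)
Lemma card_disjoint_majorities (m : nat) (A B : {set 'I_m.*2.+1}) :
  (m < #|A|)%N -> (m < #|B|)%N -> exists2 i, i \in A & i \in B.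
Proof.
move=> mA mB; have : (0 < #|A :&: B|)%N.
  have := cardsUI A B; have := max_card (A :|: B); rewrite card_ord; lia.
by rewrite card_gt0 => /set0Pn[i]; rewrite finset.inE => /andP[iA iB]; exists i.
Qed.

(** For the converse, the majority above [c] shares an index with the majority below the median, and
    that entry lies between the two. *)
Lemma order_stat_geE (R : realType) (m : nat) (y : 'I_m.*2.+1 -> R) (c : R) :
  (c <= order_stat y m.+1) = (m < #|[set i | (c <= y i)%R]%SET|)%N.
Proof.
apply/idP/idP => [ca|mc].
  apply: leq_trans (order_stat_ge_card y) (subset_leq_card _).
  by apply/fintype.subsetP => i; rewrite !finset.inE; exact: le_trans.
have [i] := card_disjoint_majorities mc (order_stat_le_card y).
by rewrite !finset.inE; exact: le_trans.
Qed.

Lemma order_stat_leE (R : realType) (m : nat) (y : 'I_m.*2.+1 -> R) (c : R) :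
  (order_stat y m.+1 <= c) = (m < #|[set i | (y i <= c)%R]%SET|)%N.
Proof.
apply/idP/idP => [ac|mc].
  apply: leq_trans (order_stat_le_card y) (subset_leq_card _).
  by apply/fintype.subsetP => i; rewrite !finset.inE => /le_trans; exact.
have [i] := card_disjoint_majorities (order_stat_ge_card y) mc.
by rewrite !finset.inE; exact: le_trans.
Qed.

(** * The noise law *)

Section reflection.
Context {R : realType}.
Notation leb := (@lebesgue_measure R).

(** By uniqueness it suffices to compare half-open intervals; reflection moves the closed end to the
    other side but keeps the length. *)
Lemma lebesgue_measure_opp (A : set R) : measurable A ->
  leb (-%R @^-1` A) = leb A.
Proof.
move=> mA; apply/esym.
have mopp : measurable_fun [set: measurableTypeR R] (-%R : R -> measurableTypeR R).
  exact: oppr_measurable.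
pose oppM : {mfun measurableTypeR R >-> measurableTypeR R} :=
  HB.pack (-%R : measurableTypeR R -> measurableTypeR R)
    (isMeasurableFun.Build _ _ _ _ _ mopp).
apply: (@lebesgue_measure_unique R (pushforward leb oppM)) => // X [[a b] _ <-].
transitivity (leb (`[- b, - a[%classic : set R)).
  by rewrite !lebesgue_measure_itv /= !lte_fin ltrN2 -!EFinB opprK addrC.
congr (leb _); apply/seteqP; split=> x /=; rewrite !in_itv/= => /andP[? ?].
  by apply/andP; split; lra.
by apply/andP; split; lra.
Qed.

Lemma ge0_integral_opp (A : set R) (f : R -> \bar R) : measurable A ->
  measurable_fun A f -> (forall x, 0 <= f x)%E ->
  (\int[leb]_(x in -%R @^-1` A) f (- x)%R = \int[leb]_(x in A) f x)%E.
Proof.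
move=> mA mf f0.
have mopp : measurable_fun [set: measurableTypeR R] (-%R : R -> measurableTypeR R).
  exact: oppr_measurable.
rewrite -(ge0_integral_pushforward mopp leb mA mf)//.
by apply: eq_measure_integral => B mB _; exact: lebesgue_measure_opp.
Qed.

End reflection.

(** * Power-law tails and the noise density *)

Lemma powR_cvgy0 (R : realType) (p : R) : 0 < p -> x `^ (- p) @[x --> +oo] --> 0.
Proof.
move=> p0; apply/cvgrPdist_le => e e0; near=> x.
have x0 : 0 < x by near: x; exact: nbhs_pinfty_gt.
rewrite sub0r normrN ger0_norm ?powR_ge0// /powR gt_eqF//.
rewrite -[leRHS]lnK ?posrE// ler_expR mulNr lerNl -ler_pdivrMl//.
rewrite -[leLHS]expRK ler_ln ?posrE ?expR_gt0//.
Unshelve. all: by end_near. Qed.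

Lemma integral_powR_tail (R : realType) (p a : R) : 0 < p -> 0 < a ->
  (\int[lebesgue_measure]_(x in `[a, +oo[) (x `^ (- (p + 1)))%:E
   = (a `^ (- p) / p)%:E)%E.
Proof.
move=> p0 a0.
have xgt0 x : a <= x -> 0 < x by exact: lt_le_trans.
(* An antiderivative that vanishes at infinity, so only its value at [a] survives. *)
pose F (x : R) := (- p^-1) * x `^ (- p).
have dF (x : R) : 0 < x -> is_derive x 1 F (x `^ (- (p + 1))).
  move=> x0; have := is_derive1_powR (- p) x0 => dx.
  have -> : x `^ (- (p + 1)) = (- p^-1) *: (- p * x `^ (- p - 1)).
    by rewrite opprD scalerA mulrNN mulVf ?gt_eqF// scale1r.
  exact: is_deriveZ.
rewrite (@ge0_continuous_FTC2y _ _ F a 0).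
- rewrite sub0e /F -EFinN; congr EFin; field; rewrite gt_eqF//.
- by move=> x ax; exact: powR_ge0.
- apply: continuous_in_subspaceT => x; rewrite inE/= in_itv/= andbT => /xgt0 x0.
  apply/differentiable_continuous/derivable1_diffP.
  by have [] := is_derive1_powR (- (p + 1)) x0.
- rewrite -[X in _ --> X](mulr0 (- p^-1)).
  by apply: cvgMl_tmp; exact: powR_cvgy0.
- by move=> x /ltW/xgt0 /dF [].
- apply/cvg_at_right_filter/differentiable_continuous/derivable1_diffP.
  by have [] := dF _ a0.
- move=> x; rewrite in_itv/= andbT => /ltW/xgt0 x0.
  by rewrite derive1E; have [_ ->] := dF _ x0.
Qed.

Lemma noise_density_ge0 (R : realType) (mu rho x : R) :
  0 <= mu -> rho <= 1 -> 0 <= noise_density mu rho x.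
Proof.
move=> mu0 rho1; rewrite /noise_density mulr_ge0 ?divr_ge0 ?mulr_ge0 ?subr_ge0 ?powR_ge0//.
Qed.

Lemma noise_densityN (R : realType) (mu rho x : R) :
  noise_density mu rho (- x) = noise_density mu rho x.
Proof.
rewrite /noise_density normrN !indicE; congr (_ * (nat_of_bool _)%:R).
by apply/idP/idP; rewrite !inE /= normrN.
Qed.

Lemma noise_density_eq0 (R : realType) (mu rho x : R) : `|x| < 1 ->
  noise_density mu rho x = 0.
Proof.
by move=> x1; rewrite /noise_density indicE memNset ?mulr0//= leNgt x1.
Qed.

Lemma noise_density_tailE (R : realType) (mu rho x : R) : 1 <= x ->
  noise_density mu rho x = (1 - rho) * mu / 2 * x `^ (- (mu + 1)).
Proof.
move=> x1; have x0 : 0 <= x by exact: le_trans x1.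
rewrite /noise_density indicE mem_set /= ger0_norm// mulr1.
by rewrite powRN invfM mulrA.
Qed.

Lemma measurable_noise_density (R : realType) (mu rho : R) (D : set R) :
  measurable_fun D (noise_density mu rho).
Proof.
apply: measurable_funTS; apply: measurable_funM.
  have -> : (fun x : R => (1 - rho) * mu / (2 * `|x| `^ (mu + 1))) =
      (fun x => (1 - rho) * mu / 2 * `|x| `^ (- (mu + 1))).
    by apply/funext => x; rewrite powRN invfM mulrA.
  apply: measurable_funM => //.
  exact: (measurableT_comp (measurable_powR _) (@normr_measurable R setT)).
apply: measurable_indic.
have := @normr_measurable R setT measurableT _ (measurable_itv `[1, +oo[).
by rewrite setTI; congr measurable; apply/seteqP; split=> x /=;
  rewrite in_itv/= andbT.
Qed.

Section noise_law.
Context {R : realType} {d : measure_display} {T : measurableType d}.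
Variables (P : probability T R) (zeta : {RV P >-> R}) (mu rho : R).
Hypotheses (mu1 : 1 < mu) (rho1 : rho <= 1).
Hypothesis law : has_noise_law zeta mu rho.
Notation leb := (@lebesgue_measure R).

Let mu0 : 0 <= mu. Proof. exact: le_trans (ltW mu1). Qed.

(** The atom sits at the fixed point of the reflection and the density is even. *)
Lemma noise_law_opp (A : set R) : measurable A ->
  P (zeta @^-1` (-%R @^-1` A)) = P (zeta @^-1` A).
Proof.
move=> mA; have mNA : measurable (-%R @^-1` A : set R).
  by rewrite -[X in measurable X]setTI; exact: (@oppr_measurable R setT).
have := law mA; have := law mNA; rewrite /distribution /pushforward => -> ->.
congr (_ + _)%E; first rewrite !diracE.
  congr (_ * (nat_of_bool _)%:R%:E)%E.
  by apply/idP/idP; rewrite !inE /= oppr0.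
transitivity (\int[leb]_(x in -%R @^-1` A) (noise_density mu rho (- x)%R)%:E)%E.
  by apply: eq_integral => x _; rewrite noise_densityN.
apply: (ge0_integral_opp (f := fun x => (noise_density mu rho x)%:E) mA).
  by apply/measurable_EFinP; exact: measurable_noise_density.
by move=> x; rewrite lee_fin noise_density_ge0.
Qed.

Lemma ge0_integral_noise_opp (f : R -> \bar R) :
  measurable_fun setT f -> (forall x, 0 <= f x)%E ->
  (\int[P]_w f (- zeta w)%R = \int[P]_w f (zeta w))%E.
Proof.
move=> mf f0.
have mz : measurable_fun [set: T] zeta := measurable_funPT zeta.
have mNz : measurable_fun [set: T] (fun w => - zeta w).
  by apply: measurableT_comp => //; exact: oppr_measurable.
rewrite -(ge0_integral_pushforward mz P measurableT mf)//.
rewrite -(ge0_integral_pushforward mNz P measurableT mf)//.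
by apply: eq_measure_integral => A mA _; exact: noise_law_opp.
Qed.

(** The density vanishes on [A], so only the atom counts. The set [[set 0]] serves the lower bound
    on the excess risk and []-1, 1[] the upper one. *)
Lemma noise_small (A : set R) : measurable A -> A 0 -> (forall x, A x -> `|x| < 1) ->
  P (zeta @^-1` A) = rho%:E.
Proof.
move=> mA A0 A1; have := law mA; rewrite /distribution /pushforward => ->.
rewrite diracE mem_set// mule1 integral0_eq ?adde0// => x /A1 x1.
by rewrite noise_density_eq0.
Qed.

Lemma noise_tail (t : R) : 1 <= t ->
  P (zeta @^-1` `[t, +oo[) = ((1 - rho) / 2 * t `^ (- mu))%:E.
Proof.
move=> t1; have t0 : 0 < t by exact: lt_le_trans t1.
have := law (measurable_itv `[t, +oo[); rewrite /distribution /pushforward => ->.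
rewrite diracE memNset; last by rewrite /= in_itv/= andbT; apply/negP; rewrite -ltNge.
rewrite mule0 add0e.
under eq_integral.
  move=> x; rewrite inE/= in_itv/= andbT => tx.
  rewrite noise_density_tailE ?(le_trans t1)// EFinM.
  over.
rewrite ge0_integralZl_EFin//=.
- rewrite integral_powR_tail//; last by exact: lt_trans mu1.
  rewrite -EFinM; congr EFin; field; rewrite gt_eqF//; exact: lt_trans mu1.
- by move=> x _; rewrite lee_fin powR_ge0.
- by apply/measurable_EFinP/measurable_funTS; exact: measurable_powR.
- by rewrite divr_ge0// mulr_ge0// subr_ge0.
Qed.

Lemma noise_tailN (t : R) : 1 <= t ->
  P (zeta @^-1` `]-oo, - t]) = ((1 - rho) / 2 * t `^ (- mu))%:E.
Proof.
move=> t1; rewrite -noise_tail// -noise_law_opp//.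
congr (P _); apply/seteqP; split=> w /=; rewrite !in_itv/= andbT; lra.
Qed.

End noise_law.

(** * The population risk *)

(** This is how symmetry enters the risk: averaging over [x] and [- x] turns the distance to [t]
    into a maximum of absolute values. *)
Lemma dist_max_norm (R : realDomainType) (x t : R) :
  `|x - t| + `|- x - t| = Num.max `|x| `|t| + Num.max `|x| `|t|.
Proof.
by have [?|?] := ger0P (x - t); have [?|?] := ger0P (- x - t);
  have [?|?] := ger0P x; have [?|?] := ger0P t; case: leP => ?; lra.
Qed.

Section noise_risk.
Context {R : realType} {d : measure_display} {T : measurableType d}.
Variables (P : probability T R) (zeta : {RV P >-> R}) (mu rho : R).
Hypotheses (mu1 : 1 < mu) (rho1 : rho <= 1).
Hypothesis law : has_noise_law zeta mu rho.
Notation leb := (@lebesgue_measure R).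

Let mzeta : measurable_fun [set: T] zeta := measurable_funPT zeta.

Let mnorm : measurable_fun [set: T] (fun w => `|zeta w|).
Proof. by apply: measurableT_comp => //; exact: normr_measurable. Qed.

Let mmax (t : R) : measurable_fun [set: T] (fun w => (Num.max `|zeta w| `|t|)%:E).
Proof. by apply/measurable_EFinP; exact: measurable_maxr. Qed.

Let mexcess (t : R) :
  measurable_fun [set: T] (fun w => (Num.max (`|t| - `|zeta w|) 0)%:E).
Proof.
apply/measurable_EFinP; apply: measurable_maxr => //.
exact: measurable_funB.
Qed.

(** Layer-cake formula: the tail probability is at most 1 on [[0, 1[] and at most
    [(1 - rho) * r ^ (- mu)] beyond, which is integrable because [mu > 1]. *)
Lemma noise_mean_lty : (\int[P]_w `|zeta w|%:E < +oo)%E.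
Proof.
pose X : {RV P >-> R} := HB.pack (fun w => `|zeta w|)
  (isMeasurableFun.Build _ _ _ _ _ mnorm).
have X0 w : 0 <= X w by exact: normr_ge0.
rewrite -(expectation_def X) ge0_expectation_ccdf//.
rewrite (@itv_bndbnd_setU _ _ _ (BLeft 1))//; last by rewrite bnd_simp.
rewrite ge0_integral_setU//=.
- rewrite lte_add_pinfty//.
    apply: (@le_lt_trans _ _ (\int[leb]_(r in `[0%R, 1%R[) 1)%E).
      apply: ge0_le_integral => //.
      - by apply: measurable_funTS; exact: ccdf_measurable.
      - by move=> r _; exact: probability_le1.
    rewrite integral_cst// mul1e.
    suff : (leb (`[0%R, 1%R[%classic : set R) < +oo)%E by [].
    by rewrite lebesgue_measure_itv/= lte_fin ltr01 ltry.
  apply: (@le_lt_trans _ _ (\int[leb]_(r in `[1%R, +oo[)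
      ((1 - rho)%:E * (r `^ (- (mu - 1 + 1)))%:E))%E).
    apply: ge0_le_integral => //.
    - by apply: measurable_funTS; exact: ccdf_measurable.
    - apply: measurable_funeM; apply/measurable_EFinP/measurable_funTS.
      exact: measurable_powR.
    - move=> r; rewrite /= in_itv/= andbT => r1.
      rewrite /ccdf /distribution /pushforward.
      apply: (@le_trans _ _ (P (zeta @^-1` `[r, +oo[ `|` zeta @^-1` `]-oo, (- r)%R]))).
        apply: le_measure; rewrite ?inE//.
        + by rewrite -[Y in measurable Y]setTI; exact: mnorm.
        + by apply: measurableU; rewrite -[X in measurable X]setTI; exact: mzeta.
        + move=> w /=; rewrite !in_itv/= !andbT => rw.
          by have := ltW rw; rewrite ler_normr => /orP[?|?]; [left|right]; lra.
      apply: (@le_trans _ _ (P (zeta @^-1` `[r, +oo[) + P (zeta @^-1` `]-oo, (- r)%R]))%E).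
        by apply: measureU2; rewrite -[Y in measurable Y]setTI; exact: mzeta.
      rewrite (noise_tail mu1 rho1 law r1) (noise_tailN mu1 rho1 law r1).
      by rewrite -EFinD -EFinM lee_fin subrK; lra.
  rewrite ge0_integralZl_EFin//=.
  - by rewrite integral_powR_tail ?subr_gt0// -EFinM ltry.
  - by move=> x _; rewrite lee_fin powR_ge0.
  - by apply/measurable_EFinP/measurable_funTS; exact: measurable_powR.
  - by rewrite subr_ge0.
- by apply: measurable_funTS; exact: ccdf_measurable.
- apply/disj_setPS => r [] /=; rewrite !in_itv/= => /andP[_ r1].
  by rewrite andbT leNgt r1.
Qed.

Lemma l1_risk_maxE (t : R) :
  l1_risk P zeta t = (\int[P]_w (Num.max `|zeta w| `|t|)%:E)%E.
Proof.
rewrite /l1_risk unlock.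
have mB : measurable_fun [set: R] (fun x : R => (`|x - t|)%:E).
  apply/measurable_EFinP; apply: measurableT_comp; first exact: normr_measurable.
  exact: measurable_funB.
have h := ge0_integral_noise_opp mu1 rho1 law mB (fun x => normr_ge0 (x - t)).
set a := (\int[P]_w (`|zeta w - t|)%:E)%E in h *.
set b := (\int[P]_w _)%E in h *.
(* Halving is valid at infinite values too, so the identity needs no integrability. *)
have double_inj (x y : \bar R) : (x + x = y + y -> x = y)%E.
  case: x y => [x| |] [y| |] // [] xy; congr EFin; lra.
apply: double_inj.
rewrite -{2}h /a /b -!ge0_integralD//.
- by apply: eq_integral => w _; rewrite -!EFinD dist_max_norm.
- by apply: (measurableT_comp mB); exact: mzeta.
- by apply: (measurableT_comp mB); exact: measurable_funN.
Qed.

(** Pointwise, [max a b = a + max (b - a) 0]. The additive form holds without knowing that the risk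
    at 0 is finite. *)
Lemma l1_risk_decomp (t : R) :
  l1_risk P zeta t =
  (l1_risk P zeta 0 + \int[P]_w (Num.max (`|t| - `|zeta w|) 0)%:E)%E.
Proof.
rewrite !l1_risk_maxE -ge0_integralD//.
apply: eq_integral => w _; rewrite -EFinD normr0; congr EFin.
by have := normr_ge0 (zeta w); do 3 case: leP => ?; lra.
Qed.

Lemma l1_risk_min0 (t : R) : (l1_risk P zeta 0 <= l1_risk P zeta t)%E.
Proof. by rewrite [leRHS]l1_risk_decomp leeDl// integral_ge0. Qed.

(** Cancelling the risk at 0 requires its finiteness, supplied by [noise_mean_lty]. *)
Lemma l1_risk_excessE (t : R) :
  (l1_risk P zeta t - l1_risk P zeta 0
   = \int[P]_w (Num.max (`|t| - `|zeta w|) 0)%:E)%E.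
Proof.
rewrite [X in (X - _)%E]l1_risk_decomp addeAC subee ?add0e//.
rewrite l1_risk_maxE; under eq_integral do rewrite normr0 max_l//.
by rewrite ge0_fin_numE ?noise_mean_lty// integral_ge0.
Qed.

(** Keep only the event [zeta = 0], where the integrand equals [|t|]. *)
Lemma l1_risk_excess_ge (t : R) :
  ((rho * `|t|)%:E <= l1_risk P zeta t - l1_risk P zeta 0)%E.
Proof.
have m0 : measurable (zeta @^-1` [set 0]).
  by rewrite -[X in measurable X]setTI; exact: mzeta.
rewrite l1_risk_excessE mulrC EFinM -(noise_small law (measurable_set1 0))//; last first.
  by move=> x ->; rewrite normr0.
rewrite -[X in (_ * P X)%E]setIT -integral_indic// -ge0_integralZl_EFin//.
- apply: ge0_le_integral => //.
  + by apply: measurable_funeM; apply/measurable_EFinP; exact: measurable_indic.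
  + move=> w _; rewrite -EFinM lee_fin indicE.
    have [|_] := boolP (w \in _); last by rewrite mulr0 le_max lexx orbT.
    by rewrite inE /= => ->; rewrite mulr1 normr0 subr0 le_max lexx.
- by apply/measurable_EFinP; exact: measurable_indic.
Qed.

(** Outside []-1, 1[] the noise exceeds [|t|] in absolute value and the integrand vanishes; inside
    it is at most [|t|]. *)
Lemma l1_risk_excess_le (t : R) : `|t| < 1 ->
  (l1_risk P zeta t - l1_risk P zeta 0 <= (rho * `|t|)%:E)%E.
Proof.
move=> t1; have mA : measurable (zeta @^-1` `]-1, 1[).
  by rewrite -[X in measurable X]setTI; exact: mzeta.
rewrite l1_risk_excessE mulrC EFinM.
rewrite -(noise_small law (measurable_itv `](-1)%R, 1%R[)); first last.
- by move=> x /=; rewrite in_itv/= ltr_norml.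
- by rewrite /= in_itv/= ltrN10 ltr01.
rewrite -[X in (_ * P X)%E]setIT -integral_indic// -ge0_integralZl_EFin//.
- apply: ge0_le_integral => //.
  + by apply: measurable_funeM; apply/measurable_EFinP; exact: measurable_indic.
  + move=> w _; rewrite -EFinM lee_fin indicE ge_max.
    have [_|] := boolP (w \in _); first by rewrite mulr1 normr_ge0 lerBlDr lerDl normr_ge0.
    rewrite notin_setE /= in_itv/= => /negP; rewrite -ltr_norml -leNgt => z1.
    by rewrite mulr0 lexx andbT; lra.
- by apply/measurable_EFinP; exact: measurable_indic.
Qed.

Lemma l1_risk_excess_geP (t : R) : 0 < rho ->
  (rho%:E <= l1_risk P zeta t - l1_risk P zeta 0)%E = (1 <= `|t|).
Proof.
move=> rho_gt0; apply/idP/idP.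
  apply: contraTT; rewrite -ltNge -ltNge => t1.
  apply: le_lt_trans (l1_risk_excess_le t1) _.
  by rewrite lte_fin gtr_pMr.
move=> t1; apply: le_trans (l1_risk_excess_ge t).
by rewrite lee_fin ler_peMr// ltW.
Qed.

End noise_risk.

(** * Majorities in an independent sample *)

Section hitting_sets.
Context {R : realType} {d : measure_display} {T : measurableType d}.
Variables (P : probability T R) (n : nat) (Y : 'I_n -> {RV P >-> R}).
Variables (B : set R) (p : R).
Hypotheses (indep : mutually_independent Y) (mB : measurable B).
Hypothesis PB : forall i, P (Y i @^-1` B) = p%:E.

(** The atoms of the algebra generated by the hits of [B]. Prescribing a set for every index lets
    independence apply directly. *)
Let pattern (S : {set 'I_n}) : set T :=
  \bigcap_(i in [set: 'I_n]) (Y i @^-1` (if i \in S then B else ~` B)).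

Let mpattern S : measurable (pattern S).
Proof.
apply: fin_bigcap_measurable => // i _; rewrite -[X in measurable X]setTI.
by apply: (measurable_funPT (Y i)) => //; case: ifP => // _; exact: measurableC.
Qed.

Let patternE (S : {set 'I_n}) w : pattern S w <-> [set i | Y i w \in B]%SET = S.
Proof.
split=> [pSw|<- i _ /=].
  apply/setP => i; rewrite finset.inE; have := pSw i I => /=.
  by case: (i \in S) => [/mem_set//|]; exact: memNset.
by rewrite finset.inE; case: (boolP (Y i w \in B)); rewrite ?inE// notin_setE.
Qed.

Let prob_pattern S : P (pattern S) = (p ^+ #|S| * (1 - p) ^+ #|~: S|)%:E.
Proof.
rewrite /pattern indep; last by move=> i; case: ifP => // _; exact: measurableC.
have mY i : measurable (Y i @^-1` B).
  by rewrite -[X in measurable X]setTI; exact: (measurable_funPT (Y i)).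
rewrite (eq_bigr (fun i => (if i \in S then p else 1 - p)%:E)); last first.
  move=> i _; case: ifP => // _.
  by rewrite preimage_setC probability_setC ?EFinB -?(PB i)//; exact: mY.
rewrite prodEFin; congr EFin; rewrite (bigID (mem S)) /=; congr (_ * _).
  by rewrite (eq_bigr (fun=> p)) ?prodr_const// => i ->.
rewrite (eq_bigr (fun=> 1 - p)) => [|i /negbTE ->//].
by rewrite prodr_const; congr (_ ^+ _); apply: eq_card => i; rewrite !finset.inE.
Qed.

Let hitE (Q : pred {set 'I_n}) :
  [set w | Q [set i | Y i w \in B]%SET] = \bigcup_(S in [set` Q]) pattern S.
Proof.
apply/seteqP; split=> [w Qw|w [S QS] /patternE /= ->//].
by exists [set i | Y i w \in B]%SET => //; apply/patternE.
Qed.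

Lemma measurable_hit (Q : pred {set 'I_n}) :
  measurable [set w | Q [set i | Y i w \in B]%SET].
Proof. by rewrite hitE; apply: fin_bigcup_measurable => //; exact: finite_finset. Qed.

(** The patterns partition the space by the random set of hits. Summing over subsets rather than
    over counts matches [binomial_tail_ge]. *)
Lemma prob_hit (Q : pred {set 'I_n}) :
  P [set w | Q [set i | Y i w \in B]%SET] =
  (\sum_(S : {set 'I_n} | Q S) p ^+ #|S| * (1 - p) ^+ #|~: S|)%:E.
Proof.
rewrite hitE measure_fin_bigcup//.
- rewrite -(@bigfs _ _ _ _ (index_enum _))/= ?index_enum_uniq//; last first.
    by move=> S _; rewrite mem_index_enum.
  by rewrite -sumEFin; apply: eq_bigr => S _; exact: prob_pattern.
- by move=> S S' _ _ [w [/patternE <- /patternE]].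
Qed.

End hitting_sets.

Lemma prob_median_outlier_ge (R : realType) (d : measure_display)
    (T : measurableType d) (P : probability T R) (m : nat)
    (Y : 'I_m.*2.+1 -> {RV P >-> R}) (rho : R) :
  mutually_independent Y ->
  (forall i, P (Y i @^-1` `[1, +oo[) = ((1 - rho) / 2)%:E) ->
  (forall i, P (Y i @^-1` `]-oo, -1]) = ((1 - rho) / 2)%:E) ->
  0 < rho <= 1 / 3 -> rho ^+ 2 * m.*2.+1%:R = 1 ->
  ((expR (- 2))%:E <=
    P [set w | (1 <= `|order_stat (fun i => Y i w) m.+1|)%R])%E.
Proof.
move=> indep Pge Ple rho03 rhon.
pose Bge : set R := `[1, +oo[%classic; pose Ble : set R := `]-oo, -1]%classic.
pose hit (B : set R) := [set w | (m < #|[set i | Y i w \in B]%SET|)%N].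
have -> : [set w | 1 <= `|order_stat (fun i => Y i w) m.+1|] =
    hit Bge `|` hit Ble.
  apply/seteqP; split=> w; rewrite /= /hit /=.
    rewrite ler_normr lerNr order_stat_geE order_stat_leE.
    move=> /orP[h|h]; [left|right]; apply: leq_trans h (subset_leq_card _);
    by apply/fintype.subsetP => i; rewrite !finset.inE mem_setE /= in_itv/= ?andbT.
  rewrite ler_normr lerNr order_stat_geE order_stat_leE.
  case=> h; apply/orP; [left|right]; apply: leq_trans h (subset_leq_card _);
    by apply/fintype.subsetP => i; rewrite !finset.inE mem_setE /= in_itv/= ?andbT.
have mge : measurable Bge by exact: measurable_itv.
have mle : measurable Ble by exact: measurable_itv.
pose heavy (S : {set 'I_m.*2.+1}) := (m < #|S|)%N.
have Ege := prob_hit indep mge Pge heavy.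
have Ele := prob_hit indep mle Ple heavy.
(* Disjointness: two majorities would share an index whose value is both at least 1 and at most
   -1. *)
rewrite measureU; first last.
- apply/seteqP; split=> // w [/= hge hle].
  have [i] := card_disjoint_majorities hge hle.
  by rewrite !finset.inE !mem_setE /= !in_itv/= andbT; lra.
- exact: (measurable_hit Y mle heavy).
- exact: (measurable_hit Y mge heavy).
apply: (@le_trans _ _ (P [set w | heavy [set i | Y i w \in Bge]%SET] +
  P [set w | heavy [set i | Y i w \in Ble]%SET])%E); last by [].
rewrite Ege Ele -EFinD lee_fin -mulr2n.
have -> : 1 - (1 - rho) / 2 = (1 + rho) / 2 by lra.
exact: binomial_tail_ge.
Qed.

Unset Implicit Arguments.

Theorem mainTheorem3 (R : realType) (mu : R) (hmu : 1 < mu <= 2) :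
  let thetastar : R := 0 in
  let rho (n : nat) : R := 1 / Num.sqrt n%:R in
  (* the population risk is minimized at thetastar *)
  (forall (m : nat) (n := m.*2.+1)
     (d0 : measure_display) (T0 : measurableType d0) (P0 : probability T0 R)
     (zeta : {RV P0 >-> R}),
     has_noise_law zeta mu (rho n) ->
     argmin (l1_risk P0 (fun w => thetastar + zeta w)) thetastar)
  /\
  (* the empirical risk of an odd sample is minimized exactly at its median *)
  (forall (m : nat) (y : 'I_m.*2.+1 -> R),
     argmin (empirical_l1_risk y) = [set order_stat y m.+1])
  /\
  exists n0 : nat, forall (m : nat) (n := m.*2.+1), (n0 <= n)%N ->
    forall (d0 : measure_display) (T0 : measurableType d0)
      (P0 : probability T0 R) (zeta : {RV P0 >-> R}),
    has_noise_law zeta mu (rho n) ->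
    let Y0 : T0 -> R := fun w => thetastar + zeta w in
    forall (d : measure_display) (T : measurableType d)
      (P : probability T R) (Y : 'I_n -> {RV P >-> R}),
    mutually_independent Y ->
    (forall i, identically_distributed P (Y i) P0 Y0) ->
    forall thetabar : T -> R,
    (forall w, argmin (empirical_l1_risk (fun i => Y i w)) (thetabar w)) ->
    (P [set w | l1_risk P0 Y0 (thetabar w) - l1_risk P0 Y0 thetastar
                >= (1 / Num.sqrt n%:R)%:E]
     >= (9 / (16 * expR 1 ^+ 2))%:E)%E.
Proof.
move=> thetastar rho.
have mu1 : 1 < mu by case/andP: hmu.
have add0 (T0 : Type) (z : T0 -> R) : (fun w => thetastar + z w) = z.
  by apply/funext => w; rewrite add0r.
have rho_gt0 m : 0 < rho m.*2.+1 by rewrite divr_gt0// sqrtr_gt0 ltr0n.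
have rho_sqr m : rho m.*2.+1 ^+ 2 * m.*2.+1%:R = 1.
  by rewrite expr_div_n expr1n sqr_sqrtr ?ler0n// div1r mulVf ?pnatr_eq0.
have rho_le1 m : rho m.*2.+1 <= 1.
  by rewrite ler_pdivrMr ?sqrtr_gt0 ?ltr0n// mul1r -[leLHS]sqrtr1 ler_wsqrtr// ler1n.
split; last split.
- move=> m n d0 T0 P0 zeta law t; rewrite add0.
  exact: (l1_risk_min0 mu1 (rho_le1 m) law).
- exact: argmin_empirical_l1_risk.
(* From [n >= 9] on, [1 / sqrt n <= 1 / 3], as the binomial bound demands. *)
exists 9%N => m n n9 d0 T0 P0 zeta law Y0 d T P Y indep idY thetabar argminY.
have rho3 : rho n <= 1 / 3.
  have := rho_sqr m; rewrite -/n.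
  have : 9 <= n%:R :> R by rewrite ler_nat.
  have := rho_gt0 m; rewrite -/n; nra.
(* The empirical minimizer is unique, so [thetabar w] is the median for every [w]; the threshold is
   [rho n] itself, so the excess event becomes the outlier event. *)
have -> : [set w | ((1 / Num.sqrt n%:R)%:E <=
    l1_risk P0 Y0 (thetabar w) - l1_risk P0 Y0 thetastar)%E] =
    [set w | (1 <= `|order_stat (fun i => Y i w) m.+1|)%R].
  apply/funext => w /=; rewrite /Y0 add0.
  rewrite (l1_risk_excess_geP mu1 (rho_le1 m) law _ (rho_gt0 m)).
  by have := argminY w; rewrite argmin_empirical_l1_risk => ->.
have PY B : measurable B -> forall i, P (Y i @^-1` B) = P0 (zeta @^-1` B).
  by move=> mB i; rewrite (idY i B mB) /Y0 add0.
apply: le_trans (prob_median_outlier_ge indep _ _ _ (rho_sqr m)).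
(* The probability bound obtained is [expR (- 2)], and [9 / 16 <= 1] yields the stated constant. *)
- have -> : expR (- 2) = (expR 1 ^+ 2)^-1 :> R.
    by rewrite expRN -[X in expR X]mulr1 expRM_natl.
  rewrite lee_fin invfM mulrA ler_piMl ?invr_ge0 ?sqr_ge0//; lra.
- move=> i; rewrite PY//.
  by rewrite (noise_tail mu1 (rho_le1 m) law)// powR1 mulr1.
- move=> i; rewrite PY//.
  by rewrite (noise_tailN mu1 (rho_le1 m) law)// powR1 mulr1.
- by rewrite rho_gt0.
Qed.
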